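(* Let $\|\cdot\|$ be any norm on $\mathbb{R}^n$ and let $\mathcal{A}$ be a real symmetric tensor of order $m$ and dimension $n$. If $m$ is an even number, then $\mathcal{A}$ is strictly copositive if and only if there is a real number $\gamma\ge 0$ such that $$\mathcal{A}x^m+\gamma\|x^+\|^m>0\quad\text{for all }x\in\mathbb{R}^n\setminus\{0\}.$$
   Context: Let $m,n$ be positive integers. A real tensor of order $m$ and dimension $n$ is an array $\mathcal{A}=(a_{i_1\cdots i_m})$ with $a_{i_1\cdots i_m}\in\mathbb{R}$, $1\le i_1,\dots,i_m\le n$. It is symmetric if its entries are invariant under every permutation of the indices. For $x\in\mathbb{R}^n$, $\mathcal{A}x^m=\sum_{i_1,\dots,i_m=1}^n a_{i_1\cdots i_m}x_{i_1}\cdots x_{i_m}$. $\mathbb{R}^n_+=\{x\in\mathbb{R}^n: x_i\ge 0 \text{ for all } i\}$. $\mathcal{A}$ is strictly copositive if $\mathcal{A}x^m>0$ for all $x\in\mathbb{R}^n_+\setminus\{0\}$. For $x\in\mathbb{R}^n$, $x^+=(x_1^+,\dots,x_n^+)^T$ with $x_i^+=\max\{x_i,0\}$. *)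

(* Defs.v *)
From mathcomp Require Import all_boot all_order all_algebra all_fingroup.
From mathcomp Require Import reals.
Set Implicit Arguments.
Unset Strict Implicit.
Unset Printing Implicit Defensive.
Import Order.TTheory GRing.Theory Num.Theory.
Local Open Scope ring_scope.

(* The entry a_{i_1...i_m} is [A i], with the multi-index given as the map
   k |-> i_k. *)
Definition tensor (R : realType) (m n : nat) : predArgType :=
  {ffun {ffun 'I_m -> 'I_n} -> R}.

Definition symmetric_tensor (R : realType) (m n : nat) (A : tensor R m n) :
    Prop :=
  forall (s : 'S_m) (i : {ffun 'I_m -> 'I_n}), A [ffun k => i (s k)] = A i.

(* The homogeneous form A x^m. *)
Definition tensor_form (R : realType) (m n : nat) (A : tensor R m n)
    (x : 'cV[R]_n) : R :=
  \sum_(i : {ffun 'I_m -> 'I_n}) A i * \prod_(k < m) x (i k) 0.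

Definition nonneg_vec (R : realType) (n : nat) (x : 'cV[R]_n) : Prop :=
  forall i, 0 <= x i 0.

Definition strictly_copositive (R : realType) (m n : nat) (A : tensor R m n) :
    Prop :=
  forall x : 'cV[R]_n, nonneg_vec x -> x != 0 -> 0 < tensor_form A x.

Definition pos_part (R : realType) (n : nat) (x : 'cV[R]_n) : 'cV[R]_n :=
  \col_i Num.max (x i 0) 0.

(* MathComp attaches a single canonical norm to a type, so an arbitrary norm on
   R^n is given as a function satisfying the norm axioms. *)
Record is_norm (R : realType) (n : nat) (N : 'cV[R]_n -> R) : Prop := IsNorm {
  is_norm_ge0 : forall x, 0 <= N x;
  is_norm_eq0 : forall x, N x = 0 -> x = 0;
  is_normZ : forall (a : R) x, N (a *: x) = `|a| * N x;
  is_norm_leD : forall x y, N (x + y) <= N x + N y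
}.

(* Main.v *)
Require Import Defs.
From mathcomp Require Import all_boot all_order all_algebra.
From mathcomp Require Import reals.
From mathcomp Require Import boolp classical_sets topology normedtype derive realfun.
Set Implicit Arguments.
Unset Strict Implicit.
Unset Printing Implicit Defensive.
Import Order.TTheory GRing.Theory Num.Theory numFieldNormedType.Exports.
Local Open Scope ring_scope.

(** Where [x^+ = 0], evenness of [m] gives [A x^m = A (-x)^m > 0]. On the unit
    sphere the set [{A x^m <= 0}] is compact and there [||x^+||^m] is positive,
    hence bounded away from 0, so a large [gamma] works on the sphere; both
    terms being positively homogeneous of degree [m], it works everywhere. The
    converse is the substitution [x := -y] with [y >= 0]. *)

Section CompactPenalty.
Local Open Scope classical_set_scope.

(** Where [f] is positive any [gamma >= 0] works, so only the compact subset where [f <= 0] matters;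
    there [f] and [g] both attain their minima, and that of [g] is positive. *)
Lemma compact_penalty (T : topologicalType) (R : realType) (K : set T)
    (f g : T -> R) :
  compact K -> continuous f -> continuous g -> (forall x, 0 <= g x) ->
  (forall x, K x -> g x = 0 -> 0 < f x) ->
  exists2 gamma : R, 0 <= gamma & forall x, K x -> 0 < f x + gamma * g x.
Proof.
move=> Kc fc gc g0 fgt0.
pose K1 := K `&` [set x | f x <= 0].
have K1c : compact K1.
  apply: compact_closedI => //.
  by apply: (preimage_closed _ (@closed_le _ 0)) => x _; exact: fc.
have [K1_0|K1_neq0] := pselect (K1 !=set0); last first.
  exists 0 => // x Kx; rewrite mul0r addr0 ltNge; apply/negP => fx.
  by apply: K1_neq0; exists x.
have [a /set_mem [Ka /= fa] fmin] :=
  compact_EVT_min K1_0 K1c (continuous_subspaceT fc).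
have [b /set_mem [Kb /= fb] gmin] :=
  compact_EVT_min K1_0 K1c (continuous_subspaceT gc).
have gb : 0 < g b.
  rewrite lt_neqAle g0 andbT eq_sym; apply/eqP => gb0.
  by move: (fgt0 b Kb gb0); rewrite ltNge fb.
(* With [f a] and [g b] the minima over [K1], this value gives [f a + gamma * g b = g b]; the
   summand [1] makes the inequality strict. *)
have gamma0 : 0 <= - f a / g b + 1.
  by rewrite addr_ge0// divr_ge0// ?oppr_ge0// ltW.
exists (- f a / g b + 1) => // x Kx.
have [fx|fx] := leP (f x) 0; last by rewrite ltr_pwDl// mulr_ge0.
have K1x : x \in K1 by apply/mem_set; split.
apply: (@lt_le_trans _ _ (f a + (- f a / g b + 1) * g b)).
  by rewrite mulrDl divfK ?gt_eqF// mul1r addrA subrr add0r.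
by rewrite lerD ?fmin// ler_wpM2l// gmin.
Qed.

End CompactPenalty.

Section NormContinuity.
Variables (R : realType) (n : nat) (N : 'cV[R]_n -> R).
Hypothesis N_norm : is_norm N.

Lemma is_norm0 : N 0 = 0.
Proof. by rewrite -(scale0r 0) (is_normZ N_norm) normr0 mul0r. Qed.

Lemma is_norm_dist (x y : 'cV[R]_n) : `|N x - N y| <= N (x - y).
Proof.
have le_sub u v : N u - N v <= N (u - v).
  by rewrite lerBlDr -{1}(subrK v u) (is_norm_leD N_norm).
have NC : N (y - x) = N (x - y).
  by rewrite -opprB -scaleN1r (is_normZ N_norm) normrN1 mul1r.
by rewrite ler_norml le_sub andbT lerNl opprB -NC le_sub.
Qed.

(** Expanding in the standard basis bounds an arbitrary norm by the coordinates, which is the half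
    of norm equivalence that continuity requires. *)
Lemma is_norm_le_sum (x : 'cV[R]_n) :
  N x <= \sum_i `|x i 0| * N (delta_mx i 0).
Proof.
rewrite {1}(matrix_sum_delta x).
under eq_bigr => i _ do rewrite big_ord1.
elim/big_ind2: _ => [|u a v b ua vb|i _]; first by rewrite is_norm0.
  by rewrite (le_trans (is_norm_leD N_norm _ _))// lerD.
by rewrite (is_normZ N_norm).
Qed.

(** Precomposing with a coordinatewise continuous [u] avoids any topology on column vectors and
    covers [pos_part v^T] directly. *)
Lemma is_norm_continuous (T : topologicalType) (u : T -> 'cV[R]_n) :
  (forall i, continuous (fun x => u x i 0)) -> continuous (fun x => N (u x)).
Proof.
move=> uc x.
(* [h] dominates the distance from [N (u x)] to [N (u y)] and tends to [h x = 0]. *)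
pose h y := \sum_i `|u x i 0 - u y i 0| * N (delta_mx i 0).
have h_cvg0 : (h y @[y --> x] --> (0 : R))%classic.
  have -> : 0 = h x by rewrite /h big1// => i _; rewrite subrr normr0 mul0r.
  apply: (cvg_big add_continuous) => i _; apply: cvgM; last exact: cvg_cst.
  by apply: cvg_norm; apply: cvgB; [exact: cvg_cst|exact: uc].
apply/cvgrPdist_le => e e_gt0.
apply: filterS (cvgr0_norm_le _ h_cvg0 _ e_gt0) => y.
apply: le_trans; apply: le_trans (ler_norm _).
rewrite (le_trans (is_norm_dist _ _))// (le_trans (is_norm_le_sum _))// /h.
by under eq_bigr => i _ do rewrite !mxE.
Qed.

End NormContinuity.

Lemma pos_partZ (R : realType) n (t : R) (x : 'cV[R]_n) : 0 <= t ->
  pos_part (t *: x) = t *: pos_part x.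
Proof.
by move=> t0; apply/matrixP => i j; rewrite !mxE maxr_pMr// mulr0.
Qed.

Lemma pos_part_eq0 (R : realType) n (x : 'cV[R]_n) :
  pos_part x = 0 <-> nonneg_vec (- x).
Proof.
split=> [x0 i|x0]; last first.
  by apply/matrixP => i j; rewrite !mxE max_r// -oppr_ge0; have := x0 i; rewrite mxE.
have /matrixP/(_ i 0) := x0; rewrite !mxE oppr_ge0 => <-.
by rewrite le_max lexx.
Qed.

Lemma tensor_formZ (R : realType) m n (A : tensor R m n) (t : R) x :
  tensor_form A (t *: x) = t ^+ m * tensor_form A x.
Proof.
rewrite /tensor_form mulr_sumr; apply: eq_bigr => i _.
under eq_bigr => k _ do rewrite mxE.
by rewrite big_split/= prodr_const card_ord mulrCA.
Qed.

Lemma tensor_formN (R : realType) m n (A : tensor R m n) x : ~~ odd m ->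
  tensor_form A (- x) = tensor_form A x.
Proof.
by move=> m_even; rewrite -scaleN1r tensor_formZ -signr_odd (negbTE m_even) mul1r.
Qed.

Lemma tensor_form_continuous (R : realType) m n (A : tensor R m n)
    (T : topologicalType) (u : T -> 'cV[R]_n) :
  (forall i, continuous (fun x => u x i 0)) ->
  continuous (fun x => tensor_form A (u x)).
Proof.
move=> uc x; apply: (continuous_big add_continuous) => {x} i _ x.
apply: cvgM; first exact: cvg_cst.
by apply: (cvg_big mul_continuous) => k _; exact: uc.
Qed.

(** Heine-Borel for row vectors. The norm here is the canonical sup norm, unrelated to the arbitrary
    norm [N]; any sphere meeting every ray from the origin would serve. *)
Lemma compact_unit_sphere (R : realType) n :
  compact [set v : 'rV[R]_n | `|v| = 1].
Proof.
apply: bounded_closed_compact.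
  exists 1; split=> // M M1 v /= ->; exact: ltW.
apply: (preimage_closed _ (@closed_eq _ 1)) => v _; exact: norm_continuous.
Qed.

Lemma strictly_copositive_penalty (R : realType) (m n : nat)
    (N : 'cV[R]_n -> R) (N_norm : is_norm N) (A : tensor R m n) :
  ~~ odd m -> strictly_copositive A ->
  exists2 gamma : R, 0 <= gamma & forall x : 'cV[R]_n, x != 0 ->
    0 < tensor_form A x + gamma * N (pos_part x) ^+ m.
Proof.
move=> m_even A_cop.
have trc i : continuous (fun v : 'rV[R]_n => v^T i 0).
  move=> v; under eq_fun do rewrite mxE; exact: coord_continuous.
have ptrc i : continuous (fun v : 'rV[R]_n => pos_part v^T i 0).
  move=> v; under eq_fun do rewrite mxE.
  apply: (@continuous_max R _ (fun v : 'rV[R]_n => v^T i 0) (fun=> 0)).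
    exact: trc.
  exact: cst_continuous.
have [|v|v|v|gamma gamma0 Hgamma] := @compact_penalty _ R _
  (fun v : 'rV[R]_n => tensor_form A v^T)
  (fun v => N (pos_part v^T) ^+ m) (@compact_unit_sphere R n).
- exact: tensor_form_continuous.
- apply: (@continuous_comp _ _ _ (fun v => N (pos_part v^T)) (fun x : R => x ^+ m)).
    exact: is_norm_continuous.
  exact: exprn_continuous.
- by rewrite exprn_ge0// (is_norm_ge0 N_norm).
(* A vanishing penalty forces [- v^T] to be nonnegative, so copositivity applies to it and evenness
   carries the sign back to [v^T]. *)
- move=> /= v1 /eqP; rewrite expf_eq0 => /andP[_ /eqP/(is_norm_eq0 N_norm)].
  move/pos_part_eq0 => v_le0; rewrite -tensor_formN//; apply: A_cop => //.
  rewrite oppr_eq0 trmx_eq0 -normr_eq0 v1; exact: oner_neq0.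
exists gamma => // x x_neq0.
have t_gt0 : 0 < `|x^T| by rewrite normr_gt0 trmx_eq0.
(* Radial projection onto the sphere; the factor [t ^+ m], with [t] the sup norm of [x], then comes
   out of both terms. *)
have -> : x = `|x^T| *: (`|x^T|^-1 *: x^T)^T.
  by rewrite linearZ/= trmxK scalerA divff ?scale1r// gt_eqF.
rewrite tensor_formZ pos_partZ ?ltW// (is_normZ N_norm) normr_id.
rewrite exprMn mulrCA -mulrDr mulr_gt0 ?exprn_gt0//.
apply: Hgamma => /=.
by rewrite normrZ normfV normr_id mulVf// gt_eqF.
Qed.

Theorem theorem3p3 (R : realType) (m n : nat) (m_gt0 : (0 < m)%N)
    (n_gt0 : (0 < n)%N) (N : 'cV[R]_n -> R) (N_norm : is_norm N)
    (A : tensor R m n) (A_sym : symmetric_tensor A) (m_even : ~~ odd m) :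
  strictly_copositive A <->
  exists gamma : R, 0 <= gamma /\
    forall x : 'cV[R]_n, x != 0 ->
      0 < tensor_form A x + gamma * N (pos_part x) ^+ m.
Proof.
split=> [A_cop|[gamma [_ Hgamma]] y y_ge0 y_neq0].
  have [gamma ? ?] := strictly_copositive_penalty N_norm m_even A_cop.
  by exists gamma.
have /pos_part_eq0 Ny0 : nonneg_vec (- - y) by rewrite opprK.
have := Hgamma (- y); rewrite oppr_eq0 Ny0 (is_norm0 N_norm) tensor_formN//.
(* The penalty at [- y] is [gamma * 0 ^+ m]; it vanishes because [0 < m], whereas [0 ^+ 0] would be
   [1]. *)
by rewrite expr0n gtn_eqF// mulr0 addr0; exact.
Qed.
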